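(* Let $(G,+)$ be a group (not necessarily abelian) with identity $0_G$, let $R$ be a reflexive relation on $G$, and let $A,B$ be nonempty subsets of $G$. Suppose $A$ is finite. Assume that $R$ is transitive and isotone and satisfies property (P5) (relative to $B$). If $A$ is stable and $B=\{0_G,b^1,\dots,b^m\}$, $m\geq 2$, where $b^lI0_G$ for each $l=1,\dots,m$, then $\mathscr{E}(A+B)\neq\mathscr{E}(A)$.
   Context: For $x,y\in G$, $xPy$ means that $xRy$ holds and $yRx$ does not; $xIy$ means that neither $xRy$ nor $yRx$ holds. $R$ is isotone if for all $g,g',z\in G$, $gRg'$ implies $(z+g)R(z+g')$ and $(g+z)R(g'+z)$. For an integer $p\geq 1$ and $g\in G$, $pg$ is the sum of $p$ copies of $g$. Superscripts on points are labels, not powers. Property (P5): for every $q\geq 1$, all integers $p_1,\dots,p_q\geq 1$ and all $c^1,\dots,c^q\in B$, $0_GR(p_1c^1+\dots+p_qc^q)$ implies that at least one $c^l$ satisfies $0_GRc^l$. The sum set is $A+B=\{a+b: a\in A, b\in B\}$. For $S\subseteq G$, $\mathscr{E}(S)$ is the set of efficient points of $S$, i.e. of those $g\in S$ for which there is no $g'\in S$ with $g'Pg$; by convention $\mathscr{E}(\emptyset)=\emptyset$. A set $S$ is stable if $\mathscr{E}(S)=S$. *)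

(* Defs.v *)
From mathcomp Require Import all_boot.
From mathcomp Require Import boolp classical_sets functions cardinality.

Set Implicit Arguments.
Unset Strict Implicit.
Unset Printing Implicit Defensive.

Local Open Scope classical_set_scope.
Local Open Scope group_scope.

(* Arbitrary (possibly infinite, non-abelian) groups are the library's
   [groupType], whose law is written multiplicatively: x + y is [x * y],
   the identity is [1], and the sum of p copies of x is [x ^+ p]. *)

Definition strictly {T : Type} (R : T -> T -> Prop) (x y : T) : Prop :=
  R x y /\ ~ R y x.

Definition incomparable {T : Type} (R : T -> T -> Prop) (x y : T) : Prop :=
  ~ R x y /\ ~ R y x.

Definition isotone {G : groupType} (R : G -> G -> Prop) : Prop :=
  forall g g' z : G, R g g' -> R (z * g) (z * g') /\ R (g * z) (g' * z).

Definition efficient {T : Type} (R : T -> T -> Prop) (S : set T) : set T :=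
  [set g | S g /\ ~ exists2 g', S g' & strictly R g' g].

Definition stable {T : Type} (R : T -> T -> Prop) (S : set T) : Prop :=
  efficient R S = S.

Definition sumset {G : groupType} (A B : set G) : set G :=
  [set a * b | a in A & b in B].

(* Repetitions among the c l are allowed; the product is taken in increasing
   order of the index. *)
Definition property_P5 {G : groupType} (R : G -> G -> Prop) (B : set G) : Prop :=
  forall (q : nat) (p : 'I_q -> nat) (c : 'I_q -> G),
    (1 <= q)%N -> (forall l, (1 <= p l)%N) -> (forall l, B (c l)) ->
    R 1 (\prod_(l < q) c l ^+ p l) -> exists l, R 1 (c l).

(* Main.v *)
Require Import Defs.
From mathcomp Require Import all_boot.
From mathcomp Require Import boolp classical_sets functions cardinality.

Local Open Scope classical_set_scope.
Local Open Scope group_scope.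

(** The law of [G] is written multiplicatively; read [R x y] as: [x] is at
    least as good as [y].

    Suppose the efficient points of [A B] were those of [A], that is, all of
    [A], and fix one element [b] of [B] incomparable with [1].  For [a] in [A],
    the point [a * b] lies in the finite set [A B], so some efficient point of
    [A B] is at least as good ([efficient_dominates]); this point is in [A].
    So every [a] in [A] has some [a'] in [A] with [R a' (a * b)].  Iterating
    inside the finite set [A], one returns to a point already visited, and by
    isotonicity the steps compose to [R a (a * b ^+ p)] with [p >= 1].
    Cancelling [a] gives [R 1 (b ^+ p)], so (P5) gives [R 1 b], which
    contradicts the incomparability of [b] and [1].

    Both uses of finiteness, the existence of dominating efficient points and
    the return to a visited point, are instances of one pigeonhole statement,
    [finite_serial_loop]. *)

(** Choosing successors yields an infinite sequence in a finite set; it takes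
    some value twice, and transitivity composes the steps in between. *)
Lemma finite_serial_loop (T : choiceType) (Q : T -> T -> Prop) (S : set T)
    (S_neq0 : S !=set0) (S_fin : finite_set S)
    (Q_trans : forall x y z, Q x y -> Q y z -> Q x z)
    (Q_serial : forall x, S x -> exists2 y, S y & Q y x) :
  exists2 z, S z & Q z z.
Proof.
have [x0 Sx0] := S_neq0.
have [f fP] : {f : T -> T & forall x, S x -> S (f x) /\ Q (f x) x}.
  apply: (choice (P := fun x y => S x -> S y /\ Q y x)) => x.
  by have [/Q_serial[y Sy Qyx]|nSx] := pselect (S x); [exists y | exists x].
pose u k := iter k f x0.
have Su k : S (u k) by elim: k => [//|k IH]; exact: (fP _ IH).1.
have Q_later i d : Q (u (i + d.+1)%N) (u i).
  elim: d => [|d IH]; first by rewrite addn1; exact: (fP _ (Su i)).2.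
  by rewrite addnS; apply: Q_trans IH; exact: (fP _ (Su _)).2.
have /finite_seqP[s S_eq] := S_fin.
have us_dup : ~~ uniq (mkseq u (size s).+1).
  apply/negP => us_uniq.
  have us_sub : {subset mkseq u (size s).+1 <= s}.
    by move=> _ /mapP[k _ ->]; have := Su k; rewrite S_eq.
  by have := uniq_leq_size us_uniq us_sub; rewrite size_mkseq ltnn.
have /(uniqPn x0)[i [j [lt_ij]]] := us_dup.
rewrite size_mkseq => lt_j; rewrite !nth_mkseq ?(ltn_trans lt_ij) // => u_ij.
exists (u i); first exact: Su.
by have := Q_later i (j - i.+1)%N; rewrite addnS -addSn subnKC // -u_ij.
Qed.

(** Otherwise every point at least as good as [x] could be strictly improved,
    and [finite_serial_loop] would give a point strictly better than itself. *)
Lemma efficient_dominates (T : choiceType) (R : T -> T -> Prop) (S : set T)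
    (S_fin : finite_set S) (R_refl : forall x, R x x)
    (R_trans : forall x y z, R x y -> R y z -> R x z) (x : T) (Sx : S x) :
  exists2 y, efficient R S y & R y x.
Proof.
apply: contrapT => no_eff.
(* [S] is cut down to the points at least as good as [x], so that an efficient
   point met there dominates [x]; it is efficient in all of [S] because
   whatever improves it is again at least as good as [x]. *)
have [| | | |z _ [Rzz]] //=
  := @finite_serial_loop _ (strictly R) [set y | S y /\ R y x].
- by exists x.
- by apply: sub_finite_set S_fin => y [].
- move=> y1 y2 y3 [R12 nR21] [R23 nR32]; split; first exact: R_trans R23.
  by move=> R31; apply: nR32; exact: R_trans R12.
- move=> y [Sy Ryx]; apply: contrapT => y_best; apply: no_eff.
  exists y => //; split=> // -[y' Sy' Py'y]; apply: y_best.
  by exists y' => //; split=> //; exact: R_trans Py'y.1 Ryx.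
Qed.

Theorem theorem10 (G : groupType) (R : G -> G -> Prop) (A B : set G)
    (R_refl : forall x : G, R x x)
    (A_neq0 : A !=set0) (B_neq0 : B !=set0)
    (A_fin : finite_set A)
    (R_trans : forall x y z : G, R x y -> R y z -> R x z)
    (R_isotone : isotone R)
    (R_P5 : property_P5 R B)
    (A_stable : stable R A)
    (m : nat) (m_ge2 : (2 <= m)%N) (b : 'I_m -> G)
    (B_def : B = [set 1] `|` range b)
    (b_incomp : forall l : 'I_m, incomparable R (b l) 1) :
  efficient R (sumset A B) <> efficient R A.
Proof.
rewrite A_stable => eff_AB.
pose c := b (Ordinal (ltnW m_ge2)).
have Bc : B c by rewrite B_def; right; exists (Ordinal (ltnW m_ge2)).
have AB_fin : finite_set (sumset A B).
  apply: finite_image2 => //; rewrite B_def finite_setU; split=> //.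
  exact: finite_image.
have step a : A a -> exists2 a', A a' & R a' (a * c).
  move=> Aa; rewrite -eff_AB; apply: efficient_dominates => //.
  by exists a => //; exists c.
(* Recording the number of factors [c] makes the step relation transitive;
   [p > 0] is what (P5) needs of the loop. *)
have [| |a _ [p p_gt0 Ra]] :=
    @finite_serial_loop _ (fun a' a => exists2 p, (0 < p)%N & R a' (a * c ^+ p))
      A A_neq0 A_fin.
- move=> x y z [p p_gt0 Rxy] [q _ Ryz].
  exists (q + p)%N; first by rewrite addn_gt0 p_gt0 orbT.
  apply: R_trans Rxy _; rewrite expgnDr mulgA.
  exact: (R_isotone _ _ (c ^+ p) Ryz).2.
- by move=> a /step[a' Aa' Ra']; exists a' => //; exists 1%N; rewrite ?expg1.
have R1 : R 1 (c ^+ p).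
  by have := (R_isotone _ _ a^-1 Ra).1; rewrite mulVg mulKg.
have [//|||_ R1c] := R_P5 1%N (fun=> p) (fun=> c) isT _ _ _ => //.
  by rewrite big_ord1.
exact: (b_incomp _).2 R1c.
Qed.
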